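(* Let $A\in\mathbb{C}^{q\times n}$, let $W\in\mathbb{C}^{n\times q}$ be nonzero, let $B\in\mathbb{C}^{q\times p}$, let $m$ be a positive integer and let $k=\max\{\mathrm{Ind}(AW),\mathrm{Ind}(WA)\}$. Consider the matrix equation $$((WA)^k)^*(WA)^{m+1}X=((WA)^k)^*(WA)^{m+1}A^{\dag}B$$ in the unknown $X\in\mathbb{C}^{n\times p}$. (1) The general solution of this equation is $$X=A^{\mathrm{wg}_m,W,\dag}B+(I_n-A^{\mathrm{wg}_m,W,\dag}A)Z,$$ where $Z\in\mathbb{C}^{n\times p}$ is arbitrary. (2) If the solution $X$ of this equation satisfies $\mathcal{R}(X)\subseteq\mathcal{R}((WA)^k)$, then $X$ is unique and $X=A^{\mathrm{wg}_m,W,\dag}B$.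
   Context: $M^{\dag}$, $M^*$, $\mathcal{R}(M)$ are the Moore-Penrose inverse, conjugate transpose and range of a complex matrix $M$. For square $M$: $M^0=I$, $\mathrm{Ind}(M)$ is the smallest nonnegative integer $k$ with $\mathrm{rank}(M^k)=\mathrm{rank}(M^{k+1})$; the core-EP inverse $M^{\mathrm{cEP}}$ is the unique $X$ with $XMX=X$ and $\mathcal{R}(X)=\mathcal{R}(X^* )=\mathcal{R}(M^{\mathrm{Ind}(M)})$. For $X,Y\in\mathbb{C}^{q\times n}$ the $W$-product is $X\star Y=XWY$, and $X^{\star l}$ is the $l$-fold $W$-product of $X$ with itself. The weighted core-EP inverse is $A^{\mathrm{cEP},W}=A((WA)^{\mathrm{cEP}})^2$; the $W$-weighted $m$-weak group inverse is $A^{\mathrm{wg}_m,W}=(A^{\mathrm{cEP},W})^{\star(m+1)}WA^{\star m}\in\mathbb{C}^{q\times n}$. The $W$-weighted $m$-weak group MP inverse is $A^{\mathrm{wg}_m,W,\dag}=WA^{\mathrm{wg}_m,W}WAA^{\dag}\in\mathbb{C}^{n\times q}$. ''General solution'' means that the set of all solutions is exactly the set of matrices of the displayed form. *)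

(* Defs.v *)
From HB Require Import structures.
From mathcomp Require Import all_boot all_order all_algebra.
From mathcomp Require Import sesquilinear spectral complex.
From mathcomp Require Import boolp classical_sets reals.

Set Implicit Arguments.
Unset Strict Implicit.
Unset Printing Implicit Defensive.

Import Order.TTheory GRing.Theory Num.Theory.

Local Open Scope classical_set_scope.
Local Open Scope ring_scope.
Local Open Scope sesquilinear_scope.

Section Definitions.
Variable C : numClosedFieldType.

(* MathComp's matrix spaces (%MS) are row spaces, hence a separate notion. *)
Definition colrange m n (X : 'M[C]_(m, n)) : set 'cV[C]_m :=
  range (fun u : 'cV[C]_n => X *m u).

Definition penrose m n (A : 'M[C]_(m, n)) (X : 'M[C]_(n, m)) : Prop :=
  [/\ A *m X *m A = A, X *m A *m X = X,
      (A *m X)^t* = A *m X & (X *m A)^t* = X *m A].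

(* The default value 0 is never used: see mpinvP. *)
Definition mpinv m n (A : 'M[C]_(m, n)) : 'M[C]_(n, m) :=
  xget 0 [set X | penrose A X].

Lemma rank_expS n (M : 'M[C]_n) k : (\rank (M ^+ k.+1) <= \rank (M ^+ k))%N.
Proof. by rewrite exprS; exact: mxrankM_maxr. Qed.

Lemma mxindex_subproof n (M : 'M[C]_n) :
  exists k, \rank (M ^+ k) == \rank (M ^+ k.+1).
Proof.
apply/not_existsP => H.
have D k : (\rank (M ^+ k) + k <= n)%N.
  elim: k => [|k IH]; first by rewrite addn0 rank_leq_row.
  apply: leq_trans IH; rewrite addnS -addSn leq_add2r ltn_neqAle rank_expS andbT.
  by apply/negP => /eqP E; apply: (H k); rewrite E.
by have := leq_trans (leq_addl _ _) (D n.+1); rewrite ltnn.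
Qed.

Definition mxindex n (M : 'M[C]_n) : nat := ex_minn (mxindex_subproof M).

Definition is_coreEP n (M X : 'M[C]_n) : Prop :=
  [/\ X *m M *m X = X, colrange X = colrange (X^t*) &
      colrange (X^t*) = colrange (M ^+ mxindex M)].

(* The default value 0 is never used: see coreEPP. *)
Definition coreEP n (M : 'M[C]_n) : 'M[C]_n := xget 0 [set X | is_coreEP M X].

Section Weighted.
Variables (q n : nat) (W : 'M[C]_(n, q)).

Definition wmul (X Y : 'M[C]_(q, n)) : 'M[C]_(q, n) := X *m W *m Y.

(* The W-product has no unit in general; only l > 0 is meaningful, and the
   value at l = 0 is the arbitrary default X of iterop. *)
Definition wexp (X : 'M[C]_(q, n)) (l : nat) : 'M[C]_(q, n) :=
  iterop l wmul X X.

Definition wcoreEP (A : 'M[C]_(q, n)) : 'M[C]_(q, n) :=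
  A *m coreEP (W *m A) ^+ 2.

Definition wmwg (m : nat) (A : 'M[C]_(q, n)) : 'M[C]_(q, n) :=
  wexp (wcoreEP A) m.+1 *m W *m wexp A m.

Definition wmwgMP (m : nat) (A : 'M[C]_(q, n)) : 'M[C]_(n, q) :=
  W *m wmwg m A *m W *m A *m mpinv A.

End Weighted.

Lemma adjM m n p (A : 'M[C]_(m, n)) (B : 'M[C]_(n, p)) :
  (A *m B)^t* = B^t* *m A^t*.
Proof. by rewrite trmx_mul map_mxM. Qed.

Lemma mulmx_adj_eq0 m n (A : 'M[C]_(m, n)) : A *m A^t* = 0 -> A = 0.
Proof.
move=> H; apply/row_matrixP => i; rewrite row0; apply/eqP.
rewrite -(dnorm_eq0 (@dotmx C n)); apply/eqP.
apply: etrans (dotmxE _ _) _.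
have /matrixP /(_ i i) := H; rewrite !mxE; apply: etrans.
by apply: eq_bigr => l _; rewrite !mxE.
Qed.

Lemma row_free_gram m n (G : 'M[C]_(m, n)) :
  row_free G -> G *m G^t* \in unitmx.
Proof.
move=> fG; rewrite -row_free_unit -kermx_eq0; apply/eqP.
set K := kermx _.
have : K *m G *m (K *m G)^t* = 0.
  by rewrite adjM mulmxA -(mulmxA K) mulmx_ker mul0mx.
by move/mulmx_adj_eq0 => H; apply: (row_free_inj fG); rewrite mul0mx.
Qed.

Lemma penrose_exists m n (A : 'M[C]_(m, n)) : exists X, penrose A X.
Proof.
have AFG : A = col_base A *m row_base A by rewrite mulmx_base.
have uG := row_free_gram (row_base_free A).
have uF : (col_base A)^t* *m col_base A \in unitmx.
  have := @row_free_gram _ _ ((col_base A)^t*); rewrite trmxCK; apply.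
  by rewrite /row_free mxrank_map mxrank_tr; exact: col_base_full.
move: (col_base A) (row_base A) AFG uG uF; move: (\rank A) => r F G AFG uG uF.
set P := invmx (G *m G^t*); set Q := invmx (F^t* *m F).
have hP : P^t* = P.
  rewrite /P trmx_inv map_invmx; congr invmx.
  by rewrite adjM trmxCK.
have hQ : Q^t* = Q.
  rewrite /Q trmx_inv map_invmx; congr invmx.
  by rewrite adjM trmxCK.
set X := G^t* *m P *m (Q *m F^t*).
have AX : A *m X = F *m (Q *m F^t*).
  by rewrite AFG /X -!mulmxA (mulmxA G) (mulmxA (G *m _)) mulmxV // mul1mx.
have XA : X *m A = G^t* *m P *m G.
  rewrite AFG /X -!mulmxA (mulmxA (F^t*)) (mulmxA Q) mulVmx //.
  by rewrite mul1mx.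
exists X; split.
- rewrite AX AFG -!mulmxA; congr (_ *m _).
  by rewrite (mulmxA (F^t*)) (mulmxA Q) mulVmx // mul1mx.
- rewrite XA /X -!mulmxA; do 2 congr (_ *m _).
  by rewrite (mulmxA G) (mulmxA (G *m _)) mulmxV // mul1mx.
- by rewrite AX !adjM trmxCK hQ mulmxA.
- by rewrite XA !adjM trmxCK hP mulmxA.
Qed.

Lemma penrose_uniq m n (A : 'M[C]_(m, n)) X Y :
  penrose A X -> penrose A Y -> X = Y.
Proof.
move=> [X1 X2 X3 X4] [Y1 Y2 Y3 Y4].
have E1 : A *m X = A *m Y.
  by rewrite -{1}Y1 -mulmxA -Y3 -X3 -adjM mulmxA X1.
have E2 : X *m A = Y *m A.
  by rewrite -{1}Y1 mulmxA mulmxA -(mulmxA (_ *m _)) -X4 -Y4 -adjM -mulmxA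
     (mulmxA A) X1.
by rewrite -X2 E2 -mulmxA E1 mulmxA Y2.
Qed.

Lemma mpinvP m n (A : 'M[C]_(m, n)) X : penrose A X <-> X = mpinv A.
Proof.
have H : penrose A (mpinv A).
  exact: (xgetPex 0 (penrose_exists A)).
by split=> [HX|->//]; exact: penrose_uniq HX H.
Qed.

Lemma colrange_subP m n p (X : 'M[C]_(m, n)) (Y : 'M[C]_(m, p)) :
  colrange X `<=` colrange Y <-> exists Z, X = Y *m Z.
Proof.
split=> [H|[Z ->] _ [u _ <-]]; last by exists (Z *m u); rewrite ?mulmxA.
suff /submxP[Z E] : (X^T <= Y^T)%MS.
  by exists Z^T; apply: trmx_inj; rewrite trmx_mul trmxK.
apply/row_subP => i; rewrite -tr_col.
have [|u _ E] := H (col i X); first by exists (delta_mx i ord0); rewrite ?colE.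
by apply/submxP; exists u^T; rewrite -trmx_mul E.
Qed.

Lemma colrange_rank m n p (X : 'M[C]_(m, n)) (Y : 'M[C]_(m, p)) Z :
  X = Y *m Z -> (\rank Y <= \rank X)%N -> colrange X = colrange Y.
Proof.
move=> E r; apply/seteqP; split; apply/colrange_subP; first by exists Z.
have : (X^T == Y^T)%MS.
  rewrite -(geq_leqif (mxrank_leqif_eq _)) ?mxrank_tr //.
  by rewrite E trmx_mul submxMl.
case/andP => _ /submxP[T ET].
by exists T^T; apply: trmx_inj; rewrite trmx_mul trmxK.
Qed.

Lemma rank_mxindex n (M : 'M[C]_n) :
  \rank (M ^+ mxindex M) = \rank (M ^+ (mxindex M).+1).
Proof. by rewrite /mxindex; case: ex_minnP => k /eqP. Qed.

Lemma coreEP_exists n (M : 'M[C]_n) : exists X, is_coreEP M X.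
Proof.
set k := mxindex M; set N := M ^+ k; set T := M ^+ k.+1.
have rT : \rank N = \rank T by exact: rank_mxindex.
have TNM : T = N *m M by rewrite /T exprSr.
have TMN : T = M *m N by rewrite /T exprS.
have [D1 D2 D3 D4] := (mpinvP T _).2 erefl; set D := mpinv T in D1 D2 D3 D4.
have rX : (\rank N <= \rank (N *m D))%N.
  rewrite rT -{1}D1 TMN; apply: leq_trans (mxrankM_maxl _ _) _.
  by rewrite -mulmxA mxrankM_maxr.
have E1 : colrange (N *m D) = colrange N by exact: colrange_rank erefl rX.
have E2 : colrange ((N *m D)^t*) = colrange N.
  apply: (@colrange_rank _ _ _ _ _ (M *m D *m D^t* *m N^t*)); last first.
    by rewrite mxrank_map mxrank_tr.
  by rewrite adjM !mulmxA -TNM; congr (_ *m _); rewrite -D3 -adjM mulmxA D2.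
exists (N *m D); split; rewrite ?E1 ?E2 //.
by rewrite -!mulmxA (mulmxA M) -TMN (mulmxA D) D2.
Qed.

Lemma is_coreEP_proj n (M X : 'M[C]_n) (N := M ^+ mxindex M) :
  is_coreEP M X -> M *m X *m N = N /\ (M *m X)^t* *m N = N.
Proof.
case=> X1 X2 X3; have := rank_mxindex M; rewrite -/N => r.
have [V NV] : exists V, N = X *m V.
  by apply/colrange_subP; rewrite X2 X3.
have [S NS] : exists S, N = X^t* *m S by apply/colrange_subP; rewrite X3.
split; last by rewrite {1}NS mulmxA -adjM mulmxA X1 -NS.
have /seteqP[_ /colrange_subP[T NT]] : colrange (M *m N) = colrange N.
  have E : M *m N = N *m M by rewrite -[LHS]exprS -[RHS]exprSr.
  by apply: (colrange_rank E); rewrite r exprS.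
by rewrite {1}NT {1}NV !mulmxA -(mulmxA M X M) -(mulmxA M (X *m M)) X1
           -(mulmxA M) -NV -NT.
Qed.

Lemma is_coreEP_uniq n (M X Y : 'M[C]_n) :
  is_coreEP M X -> is_coreEP M Y -> X = Y.
Proof.
move=> HX HY; have [PX PX'] := is_coreEP_proj HX.
have [PY PY'] := is_coreEP_proj HY.
case: HX => X1 X2 X3; case: HY => Y1 Y2 Y3.
set N := M ^+ mxindex M in PX PX' PY PY' X3 Y3.
have [U XU] : exists U, X = N *m U by apply/colrange_subP; rewrite X2 X3.
have [V YV] : exists V, Y = N *m V by apply/colrange_subP; rewrite Y2 Y3.
have [S YS] : exists S, Y = X *m S by apply/colrange_subP; rewrite Y2 Y3 X2 X3.
have MN : M *m N = N *m M by rewrite -[LHS]exprS -[RHS]exprSr.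
have E : M *m X = M *m Y.
  apply/eqP; rewrite -subr_eq0; apply/eqP.
  set D := _ - _.
  have DN : D^t* *m N = 0.
    by rewrite /D linearB /= map_mxB mulmxBl PX' PY' subrr.
  have DE : D = N *m (M *m U - M *m V).
    by rewrite mulmxBr !mulmxA -MN -!mulmxA -XU -YV.
  have /mulmx_adj_eq0 D0 : D^t* *m (D^t*)^t* = 0.
    by rewrite trmxCK {2}DE mulmxA DN mul0mx.
  by rewrite -(trmxCK D) D0 trmx0 map_mx0.
have XMY : X *m M *m Y = Y by rewrite YS mulmxA X1.
by rewrite -XMY -mulmxA -E mulmxA X1.
Qed.

Lemma coreEPP n (M X : 'M[C]_n) : is_coreEP M X <-> X = coreEP M.
Proof.
have H : is_coreEP M (coreEP M).
  exact: (xgetPex 0 (coreEP_exists M)).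
by split=> [HX|->//]; exact: is_coreEP_uniq HX H.
Qed.

End Definitions.

(* Main.v *)
(** Put [M = WA] and let [X] be its core-EP inverse.  Since [M X^2 = X] and
    [M A^dag A = M], the inverse of the theorem collapses to
    [G = X^(m+1) M^(m+1) A^dag], so that [G A = X^(m+1) M^(m+1)].  As [M X] is
    the orthogonal projector onto the range of [M^k], we have
    [(M^k)^* M^(m+1) X^(m+1) = (M^k)^*]; conversely the rows of [X] lie in the
    row space of [(M^k)^*].  Hence the equation is equivalent to
    [G A Y = G B], and [G A] is idempotent with range that of [M^k]. *)

Require Import Defs.
From mathcomp Require Import all_boot all_order all_algebra.
From mathcomp Require Import sesquilinear spectral complex.
From mathcomp Require Import boolp classical_sets reals.

Set Implicit Arguments.
Unset Strict Implicit.
Unset Printing Implicit Defensive.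

Import Order.TTheory GRing.Theory Num.Theory.

Local Open Scope classical_set_scope.
Local Open Scope ring_scope.
Local Open Scope sesquilinear_scope.

Section CoreEP.
Variables (C : numClosedFieldType) (n : nat) (M X : 'M[C]_n).
Hypothesis XP : is_coreEP M X.

(** The columns of [X] lie in the range of [M ^+ mxindex M], on which [M *m X] acts as the
    identity. *)
Lemma is_coreEP_mulXX : M *m X *m X = X.
Proof.
have [PN _] := is_coreEP_proj XP; case: XP => _ E2 E3.
have [U XU] : exists U, X = M ^+ mxindex M *m U.
  by apply/colrange_subP; rewrite E2 E3.
by rewrite {2}XU mulmxA PN.
Qed.

Lemma is_coreEP_expX j : M ^+ j *m X ^+ j.+1 = X.
Proof.
elim: j => [|j IH]; first by rewrite expr0 mul1mx expr1.
rewrite exprSr (exprS X j.+1) (exprS X j) -!mulmxE -mulmxA (mulmxA M).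
by rewrite (mulmxA (M *m X)) is_coreEP_mulXX -[X *m _]/(X * _) -exprS IH.
Qed.

Lemma is_coreEP_expMX j : M ^+ j.+1 *m X ^+ j.+1 = M *m X.
Proof. by rewrite exprS -mulmxE -mulmxA is_coreEP_expX. Qed.

Variable k : nat.
Hypothesis index_le : (mxindex M <= k)%N.

Let expM_index : M ^+ k = M ^+ mxindex M *m M ^+ (k - mxindex M).
Proof. by rewrite mulmxE -exprD subnKC. Qed.

Lemma is_coreEP_factorl : exists T, X = M ^+ k *m T.
Proof.
case: XP => _ E2 E3; have [U XU] : exists U, X = M ^+ mxindex M *m U.
  by apply/colrange_subP; rewrite E2 E3.
(* The missing powers of [M] come from [X = M ^+ j *m X ^+ j.+1] with [j = k - mxindex M]. *)
exists (U *m X ^+ (k - mxindex M)).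
rewrite -[LHS](is_coreEP_expX (k - mxindex M)) exprS -mulmxE {1}XU !mulmxA.
by rewrite mulmxE -exprD subnK.
Qed.

(** Since [X^t*] and [X] have the same range, the left factorization of [X] through [M ^+ k] passes
    to [X^t*]; then take adjoints. *)
Lemma is_coreEP_factorr : exists T, X = T *m (M ^+ k)^t*.
Proof.
case: XP => _ E2 E3.
have [S XS] : exists S, X^t* = M ^+ mxindex M *m S.
  by apply/colrange_subP; rewrite E3.
have [V NV] : exists V, M ^+ mxindex M = X *m V.
  by apply/colrange_subP; rewrite E2 E3.
have [T XT] := is_coreEP_factorl.
exists ((T *m V *m S)^t*).
by rewrite -adjM !mulmxA -XT -NV -XS trmxCK.
Qed.

Lemma adj_expM_is_coreEP : (M ^+ k)^t* *m (M *m X) = (M ^+ k)^t*.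
Proof.
have [_ PN] := is_coreEP_proj XP.
by rewrite -[M *m X]trmxCK -adjM expM_index mulmxA PN.
Qed.

Lemma is_coreEP_mulXM_expM : X *m M *m M ^+ k = M ^+ k.
Proof.
case: XP => E1 E2 E3.
have [V NV] : exists V, M ^+ mxindex M = X *m V.
  by apply/colrange_subP; rewrite E2 E3.
by rewrite expM_index mulmxA NV (mulmxA (X *m M)) E1.
Qed.

Lemma is_coreEP_expXM_expM j : X ^+ j *m M ^+ j *m M ^+ k = M ^+ k.
Proof.
elim: j => [|j IH]; first by rewrite !expr0 !mul1mx.
rewrite exprSr exprS -!mulmxE -!mulmxA.
(* Commuting the powers puts [M ^+ k] next to the innermost [X *m M], which fixes it. *)
have -> : M ^+ j *m M ^+ k = M ^+ k *m M ^+ j by rewrite !mulmxE -!exprD addnC.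
rewrite !mulmxA -(mulmxA _ X M) -(mulmxA (X ^+ j)) is_coreEP_mulXM_expM.
by rewrite -mulmxA !mulmxE -exprD addnC exprD -!mulmxE mulmxA.
Qed.

End CoreEP.

Section Weighted.
Variables (C : numClosedFieldType) (q n : nat) (W : 'M[C]_(n, q)).
Variable A : 'M[C]_(q, n).
Let M := W *m A.
Let X := coreEP M.

(** Each new factor brings [X ^+ 2 *m M], and [M *m X *m X = X] cancels one of these powers, so the
    exponent grows by one only. *)
Lemma wexp_wcoreEP l : wexp W (wcoreEP W A) l.+1 = A *m X ^+ l.+2.
Proof.
elim: l => [|l IH]; first by [].
rewrite [LHS]/(wmul W _ (wexp W _ l.+1)) IH /wmul /wcoreEP -/M -/X.
rewrite -!mulmxA (mulmxA W) -/M; congr (_ *m _).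
rewrite (exprS X l.+2) (exprS X l.+1) (exprS X l) -!mulmxE.
do 2 congr (_ *m _).
by rewrite !mulmxA (is_coreEP_mulXX ((coreEPP _ _).2 erefl)).
Qed.

Lemma wexpS l : wexp W A l.+1 = A *m M ^+ l.
Proof.
elim: l => [|l IH]; first by rewrite expr0 mulmx1.
rewrite [LHS]/(wmul W A (wexp W A l.+1)) IH /wmul.
by rewrite exprS -mulmxE !mulmxA.
Qed.

Lemma wmwgMP_expE m : (0 < m)%N ->
  wmwgMP W m A = X ^+ m.+1 *m M ^+ m.+1 *m mpinv A.
Proof.
(* Positivity keeps [wexp W A m] away from its default value at 0; from here on [m] denotes the
   predecessor. *)
case: m => // m _; rewrite /wmwgMP /wmwg wexp_wcoreEP wexpS.
have MX : M *m X ^+ m.+3 = X ^+ m.+2.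
  rewrite (exprS X m.+2) (exprS X m.+1) -!mulmxE !mulmxA.
  by rewrite (is_coreEP_mulXX ((coreEPP _ _).2 erefl)).
rewrite (exprS M m.+1) (exprSr M m) -!mulmxE -MX.
move: (X ^+ _) (M ^+ m) => Y N.
by rewrite /M !mulmxA.
Qed.

Lemma mulmx_mpinvK : M *m (mpinv A *m A) = M.
Proof.
by have [E _ _ _] := (mpinvP A _).2 erefl; rewrite /M -!mulmxA (mulmxA A) E.
Qed.

Lemma wmwgMP_mulA m : (0 < m)%N ->
  wmwgMP W m A *m A = X ^+ m.+1 *m M ^+ m.+1.
Proof.
move=> m0; rewrite wmwgMP_expE // (exprSr M) -mulmxE.
by rewrite -(mulmxA _ (mpinv A)) -mulmxA -(mulmxA (M ^+ m)) mulmx_mpinvK.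
Qed.

End Weighted.

(** The algebraic core: [P *m Q] is idempotent and fixes [K], and the two factorizations of [P] tie
    it to [K] and [K^t*]. *)
Lemma range_equation_solutions (C : numClosedFieldType) (q n p : nat)
    (K P Q : 'M[C]_n) (A : 'M[C]_(q, n)) (D : 'M[C]_(n, q)) (B : 'M[C]_(q, p)) :
  K^t* *m Q *m P = K^t* -> P *m Q *m K = K ->
  (exists T, P = K *m T) -> (exists T, P = T *m K^t*) ->
  P *m Q *m D *m A = P *m Q ->
  let G := P *m Q *m D in
  let solution (X : 'M[C]_(n, p)) := K^t* *m Q *m X = K^t* *m Q *m D *m B in
  (forall X, solution X <-> exists Z, X = G *m B + (1%:M - G *m A) *m Z) /\
  unique (fun X => solution X /\ colrange X `<=` colrange K) (G *m B).
Proof.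
move=> KQP PQK [T PT] [S PS] GA G solution.
have PQP : P *m Q *m P = P by rewrite {2}PT mulmxA PQK -PT.
(* Left multiplication by [S] turns [K^t*] into [P]; left multiplication by [K^t* *m Q] turns [P]
   back into [K^t*]. *)
have solP X : solution X <-> P *m Q *m X = G *m B.
  rewrite /solution /G; split=> [E|/(congr1 (mulmx (K^t* *m Q)))].
    by rewrite {1}PS -!(mulmxA S) E PS !mulmxA.
  by rewrite !mulmxA KQP.
have PQG : P *m Q *m G = G by rewrite /G !mulmxA PQP.
split=> [X|].
  rewrite GA; split=> [/solP E|[Z ->]].
    (* A solution serves as its own parameter [Z]. *)
    by exists X; rewrite mulmxBl mul1mx E addrC subrK.
  apply/solP; rewrite mulmxDr mulmxA PQG mulmxA mulmxBr mulmx1.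
  by rewrite (mulmxA _ P) PQP subrr mul0mx addr0.
(* Uniqueness: a solution [K *m U] is fixed by [P *m Q], hence equals [G *m B]. *)
split=> [|X [/solP <- /colrange_subP[U ->]]]; last by rewrite mulmxA PQK.
split; first by apply/solP; rewrite mulmxA PQG.
apply/colrange_subP; exists (T *m Q *m D *m B).
by rewrite /G {1}PT !mulmxA.
Qed.

Theorem theorem4p5 (R : realType) (q n p m : nat)
    (A : 'M[R[i]]_(q, n)) (W : 'M[R[i]]_(n, q)) (B : 'M[R[i]]_(q, p))
    (hW : W != 0) (hm : (0 < m)%N) :
  let k := maxn (mxindex (A *m W)) (mxindex (W *m A)) in
  let G := wmwgMP W m A in
  let solution (X : 'M[R[i]]_(n, p)) :=
    ((W *m A) ^+ k)^t* *m (W *m A) ^+ m.+1 *m X =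
    ((W *m A) ^+ k)^t* *m (W *m A) ^+ m.+1 *m mpinv A *m B in
  (forall X : 'M[R[i]]_(n, p),
     solution X <->
     exists Z : 'M[R[i]]_(n, p), X = G *m B + (1%:M - G *m A) *m Z) /\
  unique (fun X : 'M[R[i]]_(n, p) =>
            solution X /\ colrange X `<=` colrange ((W *m A) ^+ k))
         (G *m B).
Proof.
move=> k; have XP := (coreEPP (W *m A) _).2 erefl.
have ik : (mxindex (W *m A) <= k)%N by exact: leq_maxr.
have GA := wmwgMP_mulA W A hm.
rewrite /= (wmwgMP_expE W A hm) in GA *.
(* With [M = W *m A] and [X] its core-EP inverse, this takes [K = M ^+ k], [P = X ^+ m.+1],
   [Q = M ^+ m.+1] and [D = mpinv A]. *)
apply: range_equation_solutions GA.
- by rewrite -mulmxA (is_coreEP_expMX XP) (adj_expM_is_coreEP XP).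
- exact: is_coreEP_expXM_expM.
- have [T XT] := is_coreEP_factorl XP ik.
  by exists (T *m coreEP (W *m A) ^+ m); rewrite exprS -mulmxE {1}XT mulmxA.
- have [T XT] := is_coreEP_factorr XP ik.
  by exists (coreEP (W *m A) ^+ m *m T); rewrite exprSr -mulmxE {2}XT mulmxA.
Qed.
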